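(* Let $G_S$ be a (possibly disconnected) self-loop graph with $\sigma=|S|\ge1$ and loop vector $s$, and let $\widetilde G$ be its Açıkmeşe lift. The following statements are equivalent: (i) $S$ is a union of (vertex sets of) connected components of $G$; (ii) $\mathcal{L}(G_S)s=s$; (iii) $R_{G,S}(p)=\sigma/(p+1)$ for every $p>0$; (iv) $\chi_t^{\widetilde G}(g)=1+e^{-(2\sigma+1)t}-e^{-t}$ for every $t>0$.
   Context: Let $G$ be a finite undirected simple graph with vertex set $V=\{1,\dots,N\}$ (possibly disconnected), and $S\subseteq V$. The self-loop graph $G_S$ is obtained from $G$ by attaching one loop at every vertex of $S$; $\sigma=|S|$. The loop vector $s\in\mathbb{R}^N$ is the indicator vector of $S$. $\mathcal{L}(G)=D(G)-A(G)$ is the ordinary Laplacian and $\mathcal{L}(G_S):=\mathcal{L}(G)+\mathrm{diag}(s)$, a positive semidefinite matrix. The loop resolvent is $R_{G,S}(p)=s^\top(pI+\mathcal{L}(G_S))^{-1}s$ for $p>0$. For $\sigma\ge1$, the Açıkmeşe lift $\widetilde G=(\widetilde V,\widetilde E)$ of $G_S$ is the simple graph on $\widetilde V=\{1,\dots,2N+1\}$ such that: for each edge $\{i,j\}$ of $G$, both $\{i,j\}$ and $\{i+N+1,j+N+1\}$ are edges of $\widetilde G$; for each $i\in S$, both $\{i,N+1\}$ and $\{N+1,i+N+1\}$ are edges; there are no other edges. $\mathcal{L}(\widetilde G)$ is the ordinary Laplacian of $\widetilde G$. The involution matrix $T$ is the $(2N+1)\times(2N+1)$ permutation matrix of the map swapping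 $i\leftrightarrow i+N+1$ ($1\le i\le N$) and fixing $N+1$. For the nontrivial element $g$ of $\mathbb{Z}_2$, the equivariant heat character is $\chi_t^{\widetilde G}(g)=\mathrm{Tr}(e^{-t\mathcal{L}(\widetilde G)}T)$, $t>0$. *)

(* Defs.v *)
From HB Require Import structures.
From mathcomp Require Import all_boot all_order all_algebra all_fingroup.
From mathcomp Require Import all_classical all_reals all_analysis.

Set Implicit Arguments.
Unset Strict Implicit.
Unset Printing Implicit Defensive.

Import Order.TTheory GRing.Theory Num.Theory.
Import numFieldNormedType.Exports.

Local Open Scope ring_scope.

Record sgraph (V : finType) := SGraph {
  adj :> rel V;
  adj_sym : symmetric adj;
  adj_irrefl : irreflexive adj
}.

Definition components (V : finType) (G : sgraph V) : {set {set V}} :=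
  [set [set y | connect G x y] | x in [set: V]].

Section Laplacian.
Variables (R : realType) (n : nat) (G : sgraph 'I_n).

Definition adjacency_mx : 'M[R]_n := \matrix_(i, j) (G i j)%:R.

Definition degree_mx : 'M[R]_n := diag_mx (\row_i #|[set j | G i j]|%:R).

Definition laplacian : 'M[R]_n := degree_mx - adjacency_mx.

End Laplacian.

Arguments adjacency_mx R {n} G.
Arguments degree_mx R {n} G.
Arguments laplacian R {n} G.

Section SelfLoop.
Variables (R : realType) (N : nat) (G : sgraph 'I_N) (S : {set 'I_N}).

Definition loop_vec : 'cV[R]_N := \col_i (i \in S)%:R.

Definition loop_laplacian : 'M[R]_N := laplacian R G + diag_mx loop_vec^T.

Definition loop_resolvent (p : R) : R :=
  (loop_vec^T *m invmx (p%:M + loop_laplacian) *m loop_vec) 0 0.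

End SelfLoop.

Arguments loop_vec R {N} S.
Arguments loop_laplacian R {N} G S.
Arguments loop_resolvent {R N} G S p.

(* The vertices of the lift are numbered from 0, so its vertex set
   'I_(N + 1 + N) is {0, ..., 2N}: [lo i], [mid] and [hi i] have values
   i, N and i + N + 1. *)
Section Lift.
Variable N : nat.

Definition lo (i : 'I_N) : 'I_(N + 1 + N) := lshift N (lshift 1 i).
Definition mid : 'I_(N + 1 + N) := lshift N (rshift N ord0).
Definition hi (i : 'I_N) : 'I_(N + 1 + N) := rshift (N + 1) i.

Variables (G : sgraph 'I_N) (S : {set 'I_N}).

Definition lift_adj : rel 'I_(N + 1 + N) := fun u v =>
  [|| [exists i, exists j,
        G i j && (((u, v) == (lo i, lo j)) || ((u, v) == (hi i, hi j)))]
    | [exists i in S, ([set u; v] == [set lo i; mid])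
                   || ([set u; v] == [set mid; hi i])]].

Lemma lift_adj_sym : symmetric lift_adj.
Proof.
move=> u v; rewrite /lift_adj; congr (_ || _); last first.
  by under eq_existsb do rewrite finset.setUC.
apply/existsP/existsP=> -[i /existsP[j /andP[Gij uv]]];
  exists j; apply/existsP; exists i; rewrite adj_sym Gij /=;
  by case/orP: uv => /eqP[-> ->]; rewrite eqxx ?orbT.
Qed.

Lemma lift_adj_irrefl : irreflexive lift_adj.
Proof.
move=> u; apply/negP => /orP[|].
  case/existsP=> i /existsP[j /andP[Gij /orP[]]] /eqP[-> /eqP].
    by rewrite !(inj_eq (@lshift_inj _ _)) => /eqP ij; rewrite ij adj_irrefl in Gij.
  by rewrite !(inj_eq (@rshift_inj _ _)) => /eqP ij; rewrite ij adj_irrefl in Gij.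
case/existsP=> i /andP[_ /orP[]] /eqP/(congr1 (fun A : {set _} => #|A|));
  rewrite !cards2 eqxx /=.
  by rewrite (inj_eq (@lshift_inj _ _)) eq_lrshift.
by rewrite eq_lrshift.
Qed.

Definition lift_graph : sgraph 'I_(N + 1 + N) :=
  SGraph lift_adj_sym lift_adj_irrefl.

Definition swap_lo_hi (u : 'I_(N + 1 + N)) : 'I_(N + 1 + N) :=
  match fintype.split u with
  | inl w => if fintype.split w is inl i then hi i else mid
  | inr i => lo i
  end.

Lemma swap_lo_hiK : involutive swap_lo_hi.
Proof.
have splitl m n (j : 'I_m) : fintype.split (lshift n j) = inl j.
  exact: (unsplitK (inl j)).
have splitr m n (k : 'I_n) : fintype.split (rshift m k) = inr k.
  exact: (unsplitK (inr k)).
move=> u; rewrite /swap_lo_hi; case: (split_ordP u) => [w ->|i ->].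
  case: (split_ordP w) => [i ->|k ->].
    by rewrite splitr.
  by rewrite splitl splitr ord1.
by rewrite splitl splitl.
Qed.

Definition involution_mx (R : realType) : 'M[R]_(N + 1 + N) :=
  perm_mx (perm (can_inj swap_lo_hiK)).

End Lift.

Arguments mid {N}.
Arguments involution_mx N R : clear implicits.

Definition expmx (R : realType) (n : nat) (A : 'M[R]_n) : 'M[R]_n :=
  limn (series (fun k => k`!%:R^-1 *: A ^+ k)).

(* The Z/2-equivariant heat character, at the nontrivial element of Z/2. *)
Definition heat_character (R : realType) (N : nat) (G : sgraph 'I_N)
    (S : {set 'I_N}) (t : R) : R :=
  \tr (expmx (- t *: laplacian R (lift_graph G S)) *m involution_mx N R).

(* Main.v *)
Require Import Defs.
From HB Require Import structures.
From mathcomp Require Import all_boot all_order all_algebra all_fingroup.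
From mathcomp Require Import all_classical all_reals all_analysis.
From mathcomp Require Import ring lra.

Set Implicit Arguments.
Unset Strict Implicit.
Unset Printing Implicit Defensive.

Import Order.TTheory GRing.Theory Num.Theory.
Import numFieldNormedType.Exports.

Local Open Scope ring_scope.

(** Write s for the loop vector, sigma for |S|, L for the Laplacian of G,
    M = L + diag(s) for the Laplacian of the self-loop graph, A for the
    Laplacian of the lift and T for the involution.  Everything turns on one
    number, the Dirichlet energy s^T L s = s^T M s - sigma.  It is half the sum
    of (s_i - s_j)^2 over ordered adjacent pairs (i, j)
    ([laplacian_form]), so it counts the edges leaving S: it vanishes exactly
    when S is closed under adjacency, that is, when S is a union of connected
    components ([cover_components]).  As M s = L s + s, this is also the case
    exactly when M s = s.

    If M s = s, then s is an eigenvector of pI + M for the eigenvalue p + 1 and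
    the resolvent is sigma / (p + 1).  Conversely, put w = L s and
    y = (pI + M)^-1 w.  From (pI + M) s = (p + 1) s + w, the resolvent formula
    at p says that s^T y = 0, and then that w^T y = s^T L s.  But M is positive
    semidefinite, so w^T y <= |w|^2 / p; letting p grow, s^T L s <= 0
    ([loop_resolvent_closed]).

    For the heat character, index the vertices of the lift in the order lower
    copy, middle vertex, upper copy.  Then A is the block matrix with rows
    (M, -s, 0), (-s^T, 2 sigma, -s^T), (0, -s, M) ([laplacian_lift]), and T
    exchanges the two outer indices.  The heat character is the sum of
    (-t)^k / k! Tr(A^k T), and the proposed value is the sum of
    (-t)^k / k! (0^k + (2 sigma + 1)^k - 1).  If M s = s, the vectors
    u = (s, 0, -s), v = (s, -2 sigma, s) and z = (s, 1, s) are eigenvectors of A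
    for 1, 2 sigma + 1 and 0; T negates u and fixes v and z, which accounts for
    the three terms of the k-th coefficient.  On the remaining vectors
    (x, 0, y), with x and y orthogonal to s, T exchanges two copies of a space
    that A preserves, so the trace there is 0 ([trace_lift_pow_eigen]).
    Conversely, if the two sums agree for all t > 0, so do their coefficients
    ([power_series_eq0]).  The first one that sees the position of S in G is
    that of degree 3, where Tr(A^3 T) = 6 s^T M s + 12 sigma^2 + 8 sigma^3
    ([trace_lift_cube]) while (2 sigma + 1)^3 - 1 = 6 sigma + 12 sigma^2
    + 8 sigma^3; so s^T M s = sigma, and the energy vanishes. *)

(** * Matrix exponentials and power series *)

Section Series.
Local Open Scope classical_set_scope.

Lemma cvg_mx (R : realType) (m n : nat) (F : nat -> 'M[R]_(m, n))
    (E : 'M[R]_(m, n)) :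
  (forall i j, (fun k => F k i j) @ \oo --> E i j) -> F @ \oo --> E.
Proof.
move=> FE A [P PE sPA]; apply: filterS sPA _.
have PF i j : \forall k \near \oo, P i j (F k i j) by apply: FE; apply: PE.
have: \forall k \near \oo, forall ij : 'I_m * 'I_n, P ij.1 ij.2 (F k ij.1 ij.2).
  by apply: filter_forall => -[i j]; exact: PF.
by apply: filterS => k Pk i j; exact: Pk (i, j).
Qed.

(** The total absolute sum of the entries dominates the maximal absolute row
    sum, which is submultiplicative. *)
Lemma expmx_entry_le (R : realType) (n : nat) (A : 'M[R]_n) (k : nat) i j :
  `|(A ^+ k) i j| <= (\sum_u \sum_v `|A u v|) ^+ k.
Proof.
set K := (X in _ <= X ^+ k).
have K0 : 0 <= K by apply: sumr_ge0 => u _; apply: sumr_ge0.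
(* Bounding whole rows rather than entries is what makes the induction close. *)
suff rowK : \sum_v `|(A ^+ k) i v| <= K ^+ k.
  by apply: le_trans rowK; rewrite (bigD1 j)//= lerDl sumr_ge0.
elim: k => [|k IHk].
  rewrite !expr0 (bigD1 i)//= mxE eqxx normr1 big1 ?addr0// => v vi.
  by rewrite mxE eq_sym (negbTE vi) normr0.
rewrite !exprSr (le_trans _ (ler_wpM2r K0 IHk))// mulr_suml.
under eq_bigr do rewrite mxE.
apply: (@le_trans _ _ (\sum_v \sum_u `|(A ^+ k) i u| * `|A u v|)).
  apply: ler_sum => v _; apply: le_trans (ler_norm_sum _ _ _) _.
  by apply: ler_sum => u _; rewrite normrM.
rewrite exchange_big; apply: ler_sum => u _; rewrite -mulr_sumr.
apply: ler_wpM2l => //; rewrite /K [leRHS](bigD1 u)//= lerDl.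
by apply: sumr_ge0 => w _; apply: sumr_ge0.
Qed.

(** Entrywise, the series is dominated by that of the real exponential of the
    absolute sum of the entries of A. *)
Lemma expmx_cvg (R : realType) (n : nat) (A : 'M[R]_n) :
  series (fun k => k`!%:R^-1 *: A ^+ k) @ \oo --> expmx A.
Proof.
(* [expmx A] is by definition the limit, so convergence to it is [cvgn]. *)
suff: cvgn (series (fun k => k`!%:R^-1 *: A ^+ k)) by [].
pose a i j k : R := k`!%:R^-1 * (A ^+ k) i j.
have ca i j : cvgn (series (a i j)).
  apply: normed_cvg; set K := \sum_u \sum_v `|A u v|.
  apply: series_le_cvg (is_cvg_series_exp_coeff K) => k //=.
    by rewrite divr_ge0// exprn_ge0//; apply: sumr_ge0 => u _; apply: sumr_ge0.
  by rewrite normrM mulrC normfV normr_nat ler_wpM2r// expmx_entry_le.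
apply/cvg_ex; exists (\matrix_(i, j) limn (series (a i j))); apply: cvg_mx => i j.
rewrite mxE; rewrite (_ : (fun k => _) = series (a i j)); first exact: ca.
by apply/funext => k; rewrite /series/= summxE; apply: eq_bigr => l _; rewrite mxE.
Qed.

Lemma trace_expmx_cvg (R : realType) (n : nat) (A B : 'M[R]_n) :
  series (fun k => k`!%:R^-1 * \tr (A ^+ k *m B)) @ \oo --> \tr (expmx A *m B).
Proof.
have := @expmx_cvg R n A; set F := series _ => FE.
rewrite (_ : series _ = fun k => \sum_i \sum_j F k i j * B j i); last first.
  apply/funext => k; rewrite /series/=.
  transitivity (\tr (F k *m B)).
    rewrite /F /series/= mulmx_suml raddf_sum; apply: eq_bigr => l _.
    by rewrite -scalemxAl /= mxtraceZ.
  by apply: eq_bigr => i _; rewrite mxE.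
rewrite (_ : \tr _ = \sum_i \sum_j expmx A i j * B j i); last first.
  by apply: eq_bigr => i _; rewrite mxE.
apply: cvg_big => [|i _]; first exact: add_continuous.
apply: cvg_big => [|j _]; first exact: add_continuous.
apply: cvgM; last exact: cvg_cst.
exact: (cvg_comp F (fun M : 'M[R]_n => M i j) FE (@coord_continuous _ _ _ i j _)).
Qed.

Lemma cvg_expR_series (R : realType) (x : R) :
  series (fun k => k`!%:R^-1 * x ^+ k) @ \oo --> expR x.
Proof.
rewrite (_ : (fun k => _) = exp_coeff x); first exact: is_cvg_series_exp_coeff.
by rewrite exp_coeffE.
Qed.

Lemma sum_geometric_le2 (R : realType) (t : R) (n : nat) :
  0 <= t -> t <= 2^-1 -> \sum_(k < n) t ^+ k <= 2.
Proof.
move=> t0 t2; have := subrX1 t n; set g := \sum_(_ < _) _ => Eg.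
have g0 : 0 <= g by apply: sumr_ge0 => k _; apply: exprn_ge0.
have tn : 0 <= t ^+ n by apply: exprn_ge0.
nra.
Qed.

(** Convergence at t = 1 bounds the coefficients by some C.  If all coefficients
    below m vanish, then for t <= 1/2 the terms beyond m add up to at most
    2 C t^(m+1), by comparison with a geometric series; as the whole series is
    0, |a m| t^m has the same bound, and dividing by t^m and letting t tend to 0
    gives a m = 0. *)
Lemma power_series_eq0 (R : realType) (a : R^nat) :
  (forall t, 0 < t -> series (fun k => a k * t ^+ k) @ \oo --> (0 : R)) ->
  forall k, a k = 0.
Proof.
move=> a0.
have [C C0 aC] : exists2 C, 0 <= C & forall k, `|a k| <= C.
  have /cvg_series_bounded : cvgn (series a).
    apply/cvg_ex; exists 0; have := a0 1 ltr01.
    by under eq_fun do rewrite expr1n mulr1.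
  move=> [M [Mr aM]]; exists (`|M| + 1); first by rewrite addr_ge0.
  by move=> k; apply: aM => //; rewrite (le_lt_trans (ler_norm M))// ltrDl.
move=> m; elim/ltn_ind: m => m IHm.
have am (t : R) : 0 < t -> t <= 2^-1 -> `|a m| <= 2 * C * t.
  move=> t0 t2; have tm : 0 < t ^+ m by rewrite exprn_gt0.
  rewrite -(ler_pM2r tm) -[leRHS]mulrA -exprS; apply/ler_addgt0Pl => e e0.
  (* Choose a partial sum smaller than e that contains the term of index m. *)
  have /cvgrPdist_lt/(_ e e0)[n0 _ /(_ (n0 + m.+1)%N)] := a0 t t0.
  move=> /(_ (leq_addr _ _)); rewrite sub0r normrN /series/= => Se.
  move: Se; rewrite addnC (@big_cat_nat _ _ _ m)//=; last first.
    by rewrite addSnnS leq_addr.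
  rewrite big_nat big1 ?add0r => [|k km]; last by rewrite IHm ?mul0r.
  rewrite big_ltn; last by rewrite addSnnS -ltn_subLR// subnn.
  set tail := \sum_(_ <= _ < _) _ => Se.
  have tailC : `|tail| <= 2 * C * t ^+ m.+1.
    apply: le_trans (ler_norm_sum _ _ _) _.
    apply: (@le_trans _ _ (\sum_(m.+1 <= k < m.+1 + n0) C * t ^+ k)).
      apply: ler_sum => k _; rewrite normrM ler_pM//.
      by rewrite ger0_norm// exprn_ge0// ltW.
    rewrite -{1}(add0n m.+1) big_addn addKn big_mkord.
    under eq_bigr do rewrite exprD mulrA mulrC mulrA.
    rewrite -mulr_sumr (_ : 2 * C * _ = t ^+ m.+1 * C * 2); last by ring.
    by rewrite ler_wpM2l ?sum_geometric_le2 ?mulr_ge0 ?exprn_ge0 ?(ltW t0).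
  rewrite -[in leLHS](gtr0_norm tm) -normrM -[a m * _](addrK tail).
  apply: le_trans (ler_normB _ _) _; apply: lerD => //; exact: ltW.
apply/eqP; rewrite -normr_le0; apply/ler_addgt0Pl => e e0; rewrite addr0.
have D0 : 0 < 2 * C + 1 by rewrite ltr_wpDl// mulr_ge0.
pose t := Num.min 2^-1 (e / (2 * C + 1)).
have t0 : 0 < t by rewrite lt_min invr_gt0 ltr0n divr_gt0.
have t2 : t <= 2^-1 by rewrite ge_min lexx.
have te : t <= e / (2 * C + 1) by rewrite ge_min lexx orbT.
apply: le_trans (am t t0 t2) _; move: te; rewrite ler_pdivlMr// => te.
by apply: le_trans te; rewrite mulrC ler_wpM2l ?(ltW t0)// lerDl.
Qed.

End Series.

(** * Unions of components and the Dirichlet form *)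

Lemma cover_components (V : finType) (G : sgraph V) (S : {set V}) :
  (exists P : {set {set V}}, P \subset components G /\ S = finset.cover P)
    <-> fingraph.closed G S.
Proof.
split=> [[P [/fintype.subsetP PG ->]] x y Gxy|SG].
  have sub (u v : V) : G u v -> u \in finset.cover P -> v \in finset.cover P.
    move=> Guv /bigcupP[B PB uB]; apply/bigcupP; exists B => //.
    have /imsetP[w _ Bw] := PG B PB; move: uB; rewrite Bw !inE => wu.
    exact: connect_trans wu (connect1 Guv).
  by apply/idP/idP; apply: sub; rewrite // adj_sym.
exists [set [set y | connect G x y] | x in S]; split.
  by apply/fintype.subsetP => B /imsetP[x _ ->]; apply: imset_f; rewrite inE.
apply/setP => y; apply/idP/bigcupP => [yS|[B /imsetP[x xS ->]]].
  by exists [set z | connect G y z]; [exact: imset_f|rewrite inE connect0].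
by rewrite inE => xy; rewrite -(closed_connect SG xy).
Qed.

Section Dirichlet.
Variables (R : realType) (N : nat) (G : sgraph 'I_N).
Implicit Type x : 'cV[R]_N.

Lemma laplacianE i j :
  laplacian R G i j = (\sum_k (G i k)%:R) *+ (i == j) - (G i j)%:R.
Proof.
rewrite !mxE; congr (_ *+ _ - _); rewrite -sum1_card natr_sum.
by rewrite big_mkcond; apply: eq_bigr => k _; rewrite inE; case: (G i k).
Qed.

Lemma tr_laplacian : (laplacian R G)^T = laplacian R G.
Proof.
apply/matrixP => i j; rewrite mxE !laplacianE adj_sym.
by case: eqVneq => [->|ji]; rewrite ?eqxx // !mulr0n.
Qed.

Lemma laplacian_mulcv x i :
  (laplacian R G *m x) i 0 = \sum_j (G i j)%:R * (x i 0 - x j 0).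
Proof.
rewrite mxE; under eq_bigr do rewrite laplacianE mulrBl.
under [RHS]eq_bigr do rewrite mulrBr.
rewrite !sumrB; congr (_ - _); rewrite (bigD1 i)//= eqxx mulr1n mulr_suml.
by rewrite [X in _ + X]big1 ?addr0// => j ji; rewrite eq_sym (negbTE ji) mul0r.
Qed.

(** Since G is symmetric, the sums of G_ij x_i (x_i - x_j) and of
    G_ij x_j (x_j - x_i) are equal; their average is a sum of squares. *)
Lemma laplacian_form x :
  (x^T *m (laplacian R G *m x)) 0 0
    = 2^-1 * \sum_i \sum_j (G i j)%:R * (x i 0 - x j 0) ^+ 2.
Proof.
set q := LHS.
have q1 : q = \sum_i \sum_j (G i j)%:R * (x i 0 * (x i 0 - x j 0)).
  rewrite /q mxE; apply: eq_bigr => i _; rewrite mxE laplacian_mulcv mulr_sumr.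
  by apply: eq_bigr => j _; rewrite mulrCA.
have q2 : q = \sum_i \sum_j (G i j)%:R * (x j 0 * (x j 0 - x i 0)).
  rewrite q1 exchange_big; apply: eq_bigr => i _; apply: eq_bigr => j _.
  by rewrite adj_sym.
have -> : q = 2^-1 * (q + q) by field.
rewrite {1}q1 q2 -big_split; congr (_ * _); apply: eq_bigr => i _.
by rewrite -big_split; apply: eq_bigr => j _; rewrite /=; ring.
Qed.

Lemma laplacian_form_ge0 x : 0 <= (x^T *m (laplacian R G *m x)) 0 0.
Proof.
rewrite laplacian_form mulr_ge0 ?invr_ge0//.
by do 2![apply: sumr_ge0 => ? _]; rewrite mulr_ge0// sqr_ge0.
Qed.

Lemma laplacian_form_eq0 x :
  (x^T *m (laplacian R G *m x)) 0 0 <= 0 -> forall i j, G i j -> x i 0 = x j 0.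
Proof.
rewrite laplacian_form pmulr_rle0 ?invr_gt0// => q0 i j Gij.
have t0 u v : 0 <= (G u v)%:R * (x u 0 - x v 0) ^+ 2.
  by rewrite mulr_ge0// sqr_ge0.
apply/eqP; rewrite -subr_eq0 -sqrf_eq0 eq_le sqr_ge0 andbT.
apply: le_trans q0; rewrite (bigD1 i)//= (bigD1 j)//= Gij mul1r -addrA lerDl.
by rewrite addr_ge0//; do ?[apply: sumr_ge0 => ? _].
Qed.

End Dirichlet.

(** * The Laplacian of the self-loop graph and its resolvent *)

Section Loops.
Variables (R : realType) (N : nat) (G : sgraph 'I_N) (S : {set 'I_N}).
Local Notation s := (loop_vec R S).
Local Notation L := (laplacian R G).
Local Notation M := (loop_laplacian R G S).

Lemma loop_vec_sqr : s^T *m s = (#|S|%:R)%:M.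
Proof.
apply/rowP => i; rewrite ord1 !mxE -sum1_card natr_sum [RHS]big_mkcond.
by apply: eq_bigr => k _; rewrite !mxE -natrM mulnb andbb; case: (k \in S).
Qed.

Lemma loop_laplacian_mul_loop_vec : M *m s = L *m s + s.
Proof.
rewrite mulmxDl; congr (_ + _); apply/colP => i; rewrite mul_diag_mx !mxE.
by rewrite -natrM mulnb andbb.
Qed.

Lemma tr_loop_laplacian : M^T = M.
Proof. by rewrite raddfD /= tr_laplacian tr_diag_mx. Qed.

Lemma laplacian_loop_vec_closed : fingraph.closed G S -> L *m s = 0.
Proof.
move=> SG; apply/colP => i; rewrite laplacian_mulcv [RHS]mxE big1// => j _.
by case Gij: (G i j); rewrite ?mul0r// !mxE (SG _ _ Gij) subrr mulr0.
Qed.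

Lemma closed_of_laplacian_form_le0 :
  (s^T *m (L *m s)) 0 0 <= 0 -> fingraph.closed G S.
Proof.
move=> /laplacian_form_eq0 sG i j /sG; rewrite !mxE => /eqP.
by rewrite eqr_nat; case: (i \in S); case: (j \in S).
Qed.

Lemma loop_laplacian_eigen_closed : fingraph.closed G S <-> M *m s = s.
Proof.
rewrite loop_laplacian_mul_loop_vec; split=> [/laplacian_loop_vec_closed->|Ms].
  by rewrite add0r.
apply: closed_of_laplacian_form_le0; have -> : L *m s = 0.
  by apply: (addIr s); rewrite Ms add0r.
by rewrite mulmx0 mxE.
Qed.

Lemma loop_laplacian_form_ge0 (x : 'cV[R]_N) : 0 <= (x^T *m (M *m x)) 0 0.
Proof.
rewrite mulmxDl mulmxDr mxE addr_ge0 ?laplacian_form_ge0// mxE.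
apply: sumr_ge0 => i _; rewrite mul_diag_mx !mxE mulrCA mulr_ge0//.
by rewrite -expr2 sqr_ge0.
Qed.

(** Coercivity: it gives both the invertibility of pI + M and the decay of its
    inverse as p grows. *)
Lemma shifted_form_ge (p : R) (x : 'cV[R]_N) :
  p * (x^T *m x) 0 0 <= (x^T *m ((p%:M + M) *m x)) 0 0.
Proof.
rewrite [in leRHS]mulmxDl [in leRHS]mulmxDr [leRHS]mxE mul_scalar_mx.
rewrite -scalemxAr [X in _ <= X + _]mxE lerDl.
exact: loop_laplacian_form_ge0.
Qed.

Lemma sqr_colvec_eq0 (x : 'cV[R]_N) : (x^T *m x) 0 0 <= 0 -> x = 0.
Proof.
move=> x0; apply/colP => i; rewrite mxE; apply/eqP; rewrite -sqrf_eq0.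
rewrite eq_le sqr_ge0 andbT; apply: le_trans x0; rewrite mxE (bigD1 i)//= mxE.
by rewrite -expr2 lerDl; apply: sumr_ge0 => j _; rewrite mxE -expr2 sqr_ge0.
Qed.

Lemma shifted_loop_laplacian_unit (p : R) : 0 < p -> p%:M + M \in unitmx.
Proof.
move=> p0; rewrite unitmxE unitfE; apply/negP => /det0P[v /negP v0 vM]; apply: v0.
suff : v^T = 0 by move/(congr1 trmx)/eqP; rewrite trmxK trmx0.
apply: sqr_colvec_eq0; rewrite -(pmulr_rle0 _ p0).
apply: le_trans (shifted_form_ge _ _) _.
by rewrite mulmxA trmxK vM mul0mx mxE.
Qed.

Lemma loop_resolvent_eigen (p : R) :
  0 < p -> M *m s = s -> loop_resolvent G S p = #|S|%:R / (p + 1).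
Proof.
move=> p0 Ms; have pM := shifted_loop_laplacian_unit p0.
have p1 : p + 1 != 0 by rewrite gt_eqF// ltr_wpDr.
have sE : s = (p%:M + M) *m ((p + 1)^-1 *: s).
  rewrite -scalemxAr mulmxDl mul_scalar_mx Ms.
  have -> : p *: s + s = (p + 1) *: s by rewrite scalerDl scale1r.
  by rewrite scalerA mulVf// scale1r.
rewrite /loop_resolvent -mulmxA {2}sE mulKmx// -scalemxAr loop_vec_sqr.
by rewrite !mxE eqxx mulr1n mulrC.
Qed.

(** With w = L s, the resolvent formula at p forces s^T L s = w^T (pI + M)^-1 w,
    which is at most |w|^2 / p. *)
Lemma loop_resolvent_closed :
  (forall p : R, 0 < p -> loop_resolvent G S p = #|S|%:R / (p + 1)) ->
  fingraph.closed G S.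
Proof.
move=> Rp; apply: closed_of_laplacian_form_le0.
set w := L *m s; set c := (s^T *m w) 0 0; pose W := (w^T *m w) 0 0.
(* An energy c > 0 would violate p c <= W at p = (|W| + 1) / c. *)
suff cW (p : R) : 0 < p -> p * c <= W.
  rewrite leNgt; apply/negP => c0.
  have := cW ((`|W| + 1) / c); rewrite divr_gt0 ?ltr_wpDl// => /(_ isT).
  by rewrite divfK ?gt_eqF// leNgt ltr_pwDr ?ler_norm.
move=> p0; have pM := shifted_loop_laplacian_unit p0.
pose y := invmx (p%:M + M) *m w.
have wyT : w^T *m y = (y^T *m w)^T by rewrite [RHS]trmx_mul trmxK.
have wy : (w^T *m y) 0 0 = c.
  have pMs : (p%:M + M) *m s = (p + 1) *: s + w.
    rewrite mulmxDl mul_scalar_mx loop_laplacian_mul_loop_vec -/w.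
    by rewrite scalerDl scale1r addrCA addrC.
  have sE : s = (p + 1) *: (invmx (p%:M + M) *m s) + y.
    by rewrite scalemxAr -mulmxDr -pMs mulKmx.
  have := Rp p p0; rewrite /loop_resolvent => Rpp.
  have sy : s^T *m y = 0.
    have := loop_vec_sqr; rewrite {2}sE mulmxDr -scalemxAr mulmxA.
    move/matrixP/(_ 0 0); rewrite mxE [X in X + _]mxE Rpp mulrC divfK; last first.
      by rewrite gt_eqF// ltr_wpDr.
    rewrite [RHS]mxE eqxx mulr1n => /eqP.
    rewrite -subr_eq0 addrAC subrr add0r => /eqP e0.
    by apply/rowP => i; rewrite ord1 e0 mxE.
  have invT : (invmx (p%:M + M))^T = invmx (p%:M + M).
    by rewrite trmx_inv linearD /= tr_scalar_mx tr_loop_laplacian.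
  have sTE : s^T = (p + 1) *: (s^T *m invmx (p%:M + M)) + y^T.
    by rewrite {1}sE linearD linearZ /= trmx_mul invT.
  rewrite /c sTE mulmxDl -scalemxAl -mulmxA -/y sy scaler0 add0r.
  by rewrite wyT [LHS]mxE.
have py : p * (y^T *m y) 0 0 <= c.
  apply: le_trans (shifted_form_ge _ _) _; rewrite /y mulKVmx//.
  by rewrite -wy wyT [leRHS]mxE.
(* The bounds p |y|^2 <= c and w^T y = c turn |p y - w|^2 >= 0 into
   |w|^2 >= p c. *)
have : 0 <= ((p *: y - w)^T *m (p *: y - w)) 0 0.
  by rewrite mxE; apply: sumr_ge0 => i _; rewrite mxE -expr2 sqr_ge0.
have yw : (y^T *m w) 0 0 = c by rewrite -wy wyT [RHS]mxE.
have -> : (p *: y - w)^T *m (p *: y - w)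
   = p *: (p *: (y^T *m y)) - p *: (y^T *m w) - (p *: (w^T *m y) - w^T *m w).
  have -> : (p *: y - w)^T = p *: y^T - w^T by rewrite linearB linearZ.
  by rewrite mulmxBl !mulmxBr -!scalemxAl -!scalemxAr.
have entryB (A B : 'M[R]_1) : (A - B) 0 0 = A 0 0 - B 0 0 by rewrite !mxE.
have entryZ a (A : 'M[R]_1) : (a *: A) 0 0 = a * A 0 0 by rewrite mxE.
rewrite !entryB !entryZ yw wy -/W; nra.
Qed.

End Loops.

(** * The lift and its Laplacian in block form *)

Lemma eq_set2 (T : finType) (u v a b : T) :
  ([set u; v] == [set a; b]) = (u == a) && (v == b) || (u == b) && (v == a).
Proof.
apply/eqP/idP => [/setP E|/orP[]/andP[/eqP-> /eqP->]//]; last exact: finset.setUC.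
move: (E u) (E v) (E a) (E b); rewrite !inE !eqxx !orbT /=.
rewrite (eq_sym a u) (eq_sym a v) (eq_sym b u) (eq_sym b v).
by case: (u == a); case: (u == b); case: (v == a); case: (v == b).
Qed.

Section LiftEdges.
Variables (N : nat) (G : sgraph 'I_N) (S : {set 'I_N}).

Lemma lift_vertexE :
  ((forall i j : 'I_N, (lo i == lo j) = (i == j)) *
   (forall i j : 'I_N, (hi i == hi j) = (i == j)) *
   (forall i : 'I_N, (lo i == mid) = false) *
   (forall i : 'I_N, (mid == lo i) = false) *
   (forall i : 'I_N, (hi i == mid) = false) *
   (forall i : 'I_N, (mid == hi i) = false) *
   (forall i j : 'I_N, (lo i == hi j) = false) *
   (forall i j : 'I_N, (hi i == lo j) = false))%type.
Proof.
do !split=> *; rewrite ?(inj_eq (@lshift_inj _ _)) ?(inj_eq (@rshift_inj _ _));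
  by rewrite ?eq_lrshift ?eq_rlshift.
Qed.

Lemma lift_edgeE :
  ((forall i j, lift_adj G S (lo i) (lo j) = G i j) *
   (forall i j, lift_adj G S (hi i) (hi j) = G i j) *
   (forall i j, lift_adj G S (lo i) (hi j) = false) *
   (forall i j, lift_adj G S (hi i) (lo j) = false) *
   (forall i, lift_adj G S (lo i) mid = (i \in S)) *
   (forall i, lift_adj G S mid (lo i) = (i \in S)) *
   (forall i, lift_adj G S (hi i) mid = (i \in S)) *
   (forall i, lift_adj G S mid (hi i) = (i \in S)))%type.
Proof.
have lo_hi i j : lift_adj G S (lo i) (hi j) = false.
  apply/negP => /orP[/existsP[k /existsP[l /andP[_]]]|/existsP[k /andP[_]]].
    by rewrite !xpair_eqE !lift_vertexE andbF.
  by rewrite !eq_set2 !lift_vertexE !andbF.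
have lo_mid i : lift_adj G S (lo i) mid = (i \in S).
  apply/idP/idP => [|iS].
    case/orP => [/existsP[k /existsP[l /andP[_]]]|/existsP[k /andP[kS]]].
      by rewrite !xpair_eqE !lift_vertexE andbF.
    by rewrite !eq_set2 !lift_vertexE eqxx ?andbT ?orbF => /eqP->.
  by apply/orP; right; apply/existsP; exists i; rewrite iS eqxx.
have hi_mid i : lift_adj G S (hi i) mid = (i \in S).
  apply/idP/idP => [|iS].
    case/orP => [/existsP[k /existsP[l /andP[_]]]|/existsP[k /andP[kS]]].
      by rewrite !xpair_eqE !lift_vertexE /= andbF.
    by rewrite !eq_set2 !lift_vertexE eqxx ?andbT ?orbF => /eqP->.
  apply/orP; right; apply/existsP; exists i.
  by rewrite iS !eq_set2 !eqxx !orbT.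
have Gsub i j : G i j ->
    lift_adj G S (lo i) (lo j) && lift_adj G S (hi i) (hi j).
  move=> Gij; apply/andP; split; apply/orP; left; apply/existsP; exists i;
    by apply/existsP; exists j; rewrite Gij !eqxx ?orbT.
do !split=> //.
- move=> i j; apply/idP/idP => [|/Gsub/andP[]//].
  case/orP => [/existsP[k /existsP[l /andP[Gkl]]]|/existsP[k /andP[kS]]].
    by rewrite !xpair_eqE !lift_vertexE orbF => /andP[/eqP-> /eqP->].
  by rewrite !eq_set2 !lift_vertexE ?andbF.
- move=> i j; apply/idP/idP => [|/Gsub/andP[]//].
  case/orP => [/existsP[k /existsP[l /andP[Gkl]]]|/existsP[k /andP[kS]]].
    by rewrite !xpair_eqE !lift_vertexE => /andP[/eqP-> /eqP->].
  by rewrite !eq_set2 !lift_vertexE ?andbF.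
- by move=> i j; rewrite lift_adj_sym lo_hi.
- by move=> i; rewrite lift_adj_sym lo_mid.
- by move=> i; rewrite lift_adj_sym hi_mid.
Qed.

End LiftEdges.

Section Blocks.
Variables (R : realType) (N : nat).

(** The arguments are the nine blocks in reading order, for the vertices taken
    in the order [lo], [mid], [hi].  The central block is a scalar, so that the
    products below involve no 1 x 1 matrix there. *)
Definition lift_mx (a : 'M[R]_N) (b : 'cV[R]_N) (c : 'M[R]_N)
    (d : 'rV[R]_N) (e : R) (f : 'rV[R]_N)
    (g : 'M[R]_N) (h : 'cV[R]_N) (k : 'M[R]_N) : 'M[R]_(N + 1 + N) :=
  block_mx (block_mx a b d e%:M) (col_mx c f) (row_mx g h) k.

Lemma lift_mxE a b c d e f g h k : let X := lift_mx a b c d e f g h k in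
  ((forall i j, X (lo i) (lo j) = a i j) * (forall i, X (lo i) mid = b i 0) *
   (forall i j, X (lo i) (hi j) = c i j) * (forall j, X mid (lo j) = d 0 j) *
   (X mid mid = e) * (forall j, X mid (hi j) = f 0 j) *
   (forall i j, X (hi i) (lo j) = g i j) * (forall i, X (hi i) mid = h i 0) *
   (forall i j, X (hi i) (hi j) = k i j))%type.
Proof.
rewrite /lift_mx /lo /mid /hi /=.
do !split=> *; rewrite ?(block_mxEul, block_mxEur, block_mxEdl, block_mxEdr);
  rewrite ?(col_mxEu, col_mxEd, row_mxEl, row_mxEr) // mxE eqxx mulr1n //.
Qed.

Lemma mul_lift_mx a b c d e f g h k a' b' c' d' e' f' g' h' k' :
  lift_mx a b c d e f g h k *m lift_mx a' b' c' d' e' f' g' h' k' =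
  lift_mx (a *m a' + b *m d' + c *m g') (a *m b' + e' *: b + c *m h')
          (a *m c' + b *m f' + c *m k')
          (d *m a' + e *: d' + f *m g') ((d *m b' + f *m h') 0 0 + e * e')
          (d *m c' + e *: f' + f *m k')
          (g *m a' + h *m d' + k *m g') (g *m b' + e' *: h + k *m h')
          (g *m c' + h *m f' + k *m k').
Proof.
rewrite /lift_mx mulmx_block mulmx_block mul_col_row mul_block_col !mul_row_block.
rewrite mul_mx_row mul_col_mx mul_row_col add_block_mx !add_col_mx !add_row_mx.
have scal (A : 'M[R]_1) : (A 0 0)%:M = A.
  by apply/matrixP => i j; rewrite !ord1 mxE eqxx mulr1n.
rewrite !mul_mx_scalar !mul_scalar_mx.
congr (block_mx (block_mx _ _ _ _) (col_mx _ _) (row_mx _ _) _) => //.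
by rewrite [RHS]raddfD /= scal scale_scalar_mx mulrC addrAC.
Qed.

Lemma trace_mul_perm_mx n (A : 'M[R]_n) (p : {perm 'I_n}) :
  \tr (A *m perm_mx p) = \sum_i A (p i) i.
Proof.
rewrite /mxtrace; under eq_bigr do rewrite mxE.
rewrite exchange_big; apply: eq_bigr => i _; rewrite (bigD1 (p i))//=.
rewrite !mxE eqxx mulr1 big1 ?addr0// => j ji.
by rewrite !mxE eq_sym (negbTE ji) mulr0.
Qed.

(** Multiplying by the involution exchanges the outer columns, which brings the
    two corner blocks and the central one onto the diagonal. *)
Lemma trace_lift_mx_involution a b c d e f g h k :
  \tr (lift_mx a b c d e f g h k *m involution_mx N R) = \tr c + e + \tr g.
Proof.
rewrite trace_mul_perm_mx !big_split_ord /= big_ord1.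
have splitl m n (j : 'I_m) : fintype.split (lshift n j) = inl j.
  exact: (unsplitK (inl j)).
have splitr m n (j : 'I_n) : fintype.split (rshift m j) = inr j.
  exact: (unsplitK (inr j)).
have swap_mid : swap_lo_hi (@mid N) = mid by rewrite /swap_lo_hi splitl splitr.
have swap_lo i : swap_lo_hi (@lo N i) = hi i by rewrite /swap_lo_hi !splitl.
have swap_hi i : swap_lo_hi (@hi N i) = lo i by rewrite /swap_lo_hi splitr.
rewrite [RHS]addrC [X in _ = _ + X]addrC addrA; congr (_ + _ + _).
- by apply: eq_bigr => i _; rewrite permE swap_lo lift_mxE.
- by rewrite permE swap_mid lift_mxE.
- by apply: eq_bigr => i _; rewrite permE swap_hi lift_mxE.
Qed.

Variables (G : sgraph 'I_N) (S : {set 'I_N}).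
Local Notation s := (loop_vec R S).
Local Notation M := (loop_laplacian R G S).

Lemma laplacian_lift :
  laplacian R (lift_graph G S) =
  lift_mx M (- s) 0 (- s^T) (2 * #|S|%:R) (- s^T) 0 (- s) M.
Proof.
have Sum : \sum_i (i \in S)%:R = #|S|%:R :> R.
  rewrite -sum1_card natr_sum [RHS]big_mkcond.
  by apply: eq_bigr => i _; case: (i \in S).
have deg_lo i : \sum_v (lift_graph G S (lo i) v)%:R
    = \sum_j (G i j)%:R + (i \in S)%:R :> R.
  rewrite !big_split_ord /= big_ord1 [X in _ + X]big1 ?addr0; last first.
    by move=> j _; rewrite -/(hi j) lift_edgeE.
  by congr (_ + _); [apply: eq_bigr => j _|]; rewrite lift_edgeE.
have deg_hi i : \sum_v (lift_graph G S (hi i) v)%:R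
    = \sum_j (G i j)%:R + (i \in S)%:R :> R.
  rewrite !big_split_ord /= big_ord1 [X in X + _ + _]big1 ?add0r; last first.
    by move=> j _; rewrite -/(lo j) lift_edgeE.
  by rewrite addrC; congr (_ + _); [apply: eq_bigr => j _|]; rewrite lift_edgeE.
have deg_mid : \sum_v (lift_graph G S mid v)%:R = 2 * #|S|%:R :> R.
  rewrite !big_split_ord /= big_ord1 -/mid lift_adj_irrefl addr0 -Sum mulr_natl mulr2n.
  by congr (_ + _); apply: eq_bigr => j _; rewrite lift_edgeE.
have ME i j : M i j = (\sum_k (G i k)%:R + (i \in S)%:R) *+ (i == j) - (G i j)%:R.
  rewrite mxE laplacianE mxE mulrnDl addrAC; congr (_ + _ - _).
  by rewrite !mxE.
have split3 (P : 'I_(N + 1 + N) -> Prop) :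
    (forall i, P (lo i)) -> P mid -> (forall i, P (hi i)) -> forall u, P u.
  move=> Plo Pmid Phi u; case: (split_ordP u) => [w ->|i ->]; last exact: Phi.
  by case: (split_ordP w) => [i ->|i ->]; rewrite ?ord1; [exact: Plo|exact: Pmid].
have sE i : s i 0 = (i \in S)%:R by rewrite mxE.
apply/matrixP => u v; rewrite laplacianE; move: v.
elim/split3: u => [i||i].
- rewrite deg_lo; elim/split3=> [j||j]; rewrite lift_mxE lift_vertexE.
  + by rewrite /= lift_edgeE ME.
  + by rewrite /= lift_edgeE sub0r [RHS]mxE sE.
  + by rewrite /= lift_edgeE subr0 mxE.
- rewrite deg_mid; elim/split3=> [j||j]; rewrite lift_mxE ?lift_vertexE ?eqxx.
  + by rewrite /= lift_edgeE sub0r [RHS]mxE mxE sE.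
  + by rewrite /= lift_adj_irrefl subr0.
  + by rewrite /= lift_edgeE sub0r [RHS]mxE mxE sE.
- rewrite deg_hi; elim/split3=> [j||j]; rewrite lift_mxE lift_vertexE.
  + by rewrite /= lift_edgeE subr0 mxE.
  + by rewrite /= lift_edgeE sub0r [RHS]mxE sE.
  + by rewrite /= lift_edgeE ME.
Qed.

End Blocks.

(** * Traces of the powers of the lift Laplacian *)

Lemma exprD_orthogonal (A : pzRingType) (a b : A) (k : nat) :
  a * b = 0 -> b * a = 0 -> (a + b) ^+ k.+1 = a ^+ k.+1 + b ^+ k.+1.
Proof.
move=> ab ba; elim: k => [|k IHk]; first by rewrite !expr1.
have abk : a * b ^+ k.+1 = 0 by rewrite exprS mulrA ab mul0r.
have bak : b * a ^+ k.+1 = 0 by rewrite exprS mulrA ba mul0r.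
by rewrite exprS IHk mulrDl !mulrDr abk bak addr0 add0r -!exprS.
Qed.

Section Traces.
Variables (R : realType) (N : nat) (G : sgraph 'I_N) (S : {set 'I_N}).
Local Notation s := (loop_vec R S).
Local Notation M := (loop_laplacian R G S).
Local Notation sigma := (#|S|%:R : R).
Local Notation A := (laplacian R (lift_graph G S)).
Local Notation T := (involution_mx N R).

(** The lowest power whose trace depends on how S sits in G:
    Tr(T) = 1, Tr(A T) = 2 sigma and Tr(A^2 T) = 4 sigma^2 + 4 sigma depend
    on sigma alone. *)
Lemma trace_lift_cube :
  \tr (A ^+ 3 *m T)
    = 6 * (s^T *m (M *m s)) 0 0 + 12 * sigma ^+ 2 + 8 * sigma ^+ 3.
Proof.
have -> : A ^+ 3 = A *m (A *m A) by rewrite !exprS expr0 mulr1.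
have trq (B : 'M[R]_N) : \tr (B *m (s *m s^T)) = (s^T *m (B *m s)) 0 0.
  by rewrite mulmxA mxtrace_mulC /mxtrace big_ord1.
have trs (w : 'rV[R]_N) : \tr (s *m w) = (w *m s) 0 0.
  by rewrite mxtrace_mulC /mxtrace big_ord1.
rewrite laplacian_lift !mul_lift_mx trace_lift_mx_involution.
rewrite !(mulmx0, mul0mx, addr0, add0r, mulNmx, mulmxN, scalerN, opprK).
rewrite -!opprD !(mulNmx, mulmxN, opprK).
have entryD (B C : 'M[R]_1) : (B + C) 0 0 = B 0 0 + C 0 0 by rewrite mxE.
have entryZ a (B : 'M[R]_1) : (a *: B) 0 0 = a * B 0 0 by rewrite mxE.
have entry1 (a : R) : a%:M 0 0 = a :> R by rewrite mxE eqxx mulr1n.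
rewrite !mxtraceD !trq !trs.
(* M is a sum by definition; as a variable it is not distributed over. *)
move: (loop_laplacian R G S) => B.
rewrite !mulmxDl !mulmxDr -!scalemxAl -!scalemxAr -!mulmxA.
rewrite !(loop_vec_sqr, opprD, opprK, entryD, entryZ, entry1).
by ring.
Qed.

(** When M s = s, the projection P onto the line of s commutes with M, and A is
    the sum of two matrices D and K whose products vanish.  D has Q = M - P in
    its two outer diagonal blocks and 0 elsewhere, so Tr(D^k T) = 0 for k > 0.
    K lives on the span of u = (s, 0, -s) and v = (s, -2 sigma, s), with
    eigenvalues 1 and 2 sigma + 1; as T u = -u and T v = v, it follows that
    Tr(K^k T) = (2 sigma + 1)^k - 1 for k > 0. *)
Lemma trace_lift_pow_eigen (k : nat) : S != finset.set0 -> M *m s = s ->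
  \tr (A ^+ k *m T) = 0 ^+ k + (2 * sigma + 1) ^+ k - 1.
Proof.
move=> S0 Ms; have sig0 : sigma != 0 by rewrite pnatr_eq0 cards_eq0.
have sM : s^T *m M = s^T by rewrite -[M]tr_loop_laplacian -trmx_mul Ms.
case: k => [|k].
  rewrite !expr0 addrK mul1mx.
  have -> : T = 1%:M *m T by rewrite mul1mx.
  have -> : (1%:M : 'M[R]_(N + 1 + N)) = lift_mx 1%:M 0 0 0 1 0 0 0 1%:M.
    by rewrite /lift_mx !scalar_mx_block col_mx0 row_mx0.
  by rewrite trace_lift_mx_involution mxtrace0 add0r addr0.
pose P := sigma^-1 *: (s *m s^T); pose Q := M - P.
have ssT : s *m s^T = sigma *: P by rewrite scalerA mulfV// scale1r.
have Ps : P *m s = s.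
  by rewrite -scalemxAl -mulmxA loop_vec_sqr mul_mx_scalar scalerA mulVf// scale1r.
have sP : s^T *m P = s^T.
  by rewrite -scalemxAr mulmxA loop_vec_sqr mul_scalar_mx scalerA mulVf// scale1r.
have PP : P *m P = P by rewrite {2}/P -scalemxAr mulmxA Ps.
have trP : \tr P = 1.
  by rewrite mxtraceZ mxtrace_mulC loop_vec_sqr mxtrace_scalar mulr1n mulVf.
have MP : M *m P = P by rewrite -scalemxAr mulmxA Ms.
have PM : P *m M = P by rewrite -scalemxAl -mulmxA sM.
clearbody P.
have PQ : P *m Q = 0 by rewrite mulmxBr PM PP subrr.
have QP : Q *m P = 0 by rewrite mulmxBl MP PP subrr.
have Qs : Q *m s = 0 by rewrite mulmxBl Ms Ps subrr.
have sQ : s^T *m Q = 0 by rewrite mulmxBr sM sP subrr.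
have MQP : M = Q + P by rewrite subrK.
clearbody Q.
(* [K c] is (u u^T + c v v^T) / (2 sigma), where v v^T has the eigenvalue
   2 sigma (2 sigma + 1): powers of [K 1] keep this form, c being multiplied
   by 2 sigma + 1 at each step. *)
pose D := lift_mx Q 0 0 0 0 0 0 0 Q.
pose K (c : R) := lift_mx (((c + 1) / 2) *: P) (- c *: s) (((c - 1) / 2) *: P)
  (- c *: s^T) (2 * sigma * c) (- c *: s^T) (((c - 1) / 2) *: P) (- c *: s)
  (((c + 1) / 2) *: P).
have lift_mx0 : lift_mx 0 0 0 0 0 0 0 0 0 = 0 :> 'M[R]_(N + 1 + N).
  by rewrite /lift_mx raddf0 col_mx0 row_mx0 !block_mx0.
have AE : A = D + K 1.
  rewrite laplacian_lift /D /K /lift_mx !add_block_mx add_col_mx add_row_mx.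
  rewrite subrr mul0r scale0r divff ?pnatr_eq0// !scale1r !scaleN1r !add0r.
  by rewrite MQP mulr1 -raddfD /= add0r.
have DK c : D *m K c = 0.
  rewrite mul_lift_mx !(mul0mx, mulmx0, scale0r, scaler0, mul0r, add0r, addr0).
  by rewrite -!scalemxAr QP Qs !scaler0 mxE lift_mx0.
have KD c : K c *m D = 0.
  rewrite mul_lift_mx !(mul0mx, mulmx0, scale0r, scaler0, mulr0, add0r, addr0).
  by rewrite -!scalemxAl PQ sQ !scaler0 mxE lift_mx0.
have Dpow : D ^+ k.+1 = lift_mx (Q ^+ k.+1) 0 0 0 0 0 0 0 (Q ^+ k.+1).
  elim: k => [|k IHk]; first by rewrite !expr1.
  rewrite exprS IHk [LHS]mul_lift_mx.
  rewrite !(mul0mx, mulmx0, scale0r, scaler0, mul0r, add0r, addr0) mxE.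
  by rewrite !exprS.
have Kstep c : K 1 *m K c = K ((2 * sigma + 1) * c).
  rewrite mul_lift_mx /K subrr mul0r scale0r !mul0mx !addr0 !add0r.
  rewrite -!scalemxAl -!scalemxAr !scalerA PP Ps sP ssT loop_vec_sqr.
  rewrite !scalerA -!scalerDl !mxE eqxx mulr1n.
  congr lift_mx; try by congr (_ *: _); field.
  by rewrite /GRing.scale /=; ring.
have Kpow : K 1 ^+ k.+1 = K ((2 * sigma + 1) ^+ k).
  elim: (k) => [|l IHl]; first by rewrite expr1 expr0.
  by rewrite exprS IHl [LHS]Kstep -exprS.
rewrite AE (exprD_orthogonal _ (DK 1) (KD 1)) mulmxDl linearD /= Dpow Kpow.
rewrite !trace_lift_mx_involution mxtrace0 mxtraceZ trP exprS mul0r exprS.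
by field.
Qed.

End Traces.

Lemma scale_mx_exp (R : comNzRingType) (n : nat) (a : R) (A : 'M[R]_n) (k : nat) :
  (a *: A) ^+ k = a ^+ k *: A ^+ k.
Proof.
elim: k => [|k IHk]; first by rewrite !expr0 scale1r.
rewrite !exprS IHk -[LHS]/((a *: A) *m (a ^+ k *: A ^+ k)).
by rewrite -scalemxAl -scalemxAr scalerA.
Qed.

(** * The heat character as a power series *)

Section Heat.
Local Open Scope classical_set_scope.
Variables (R : realType) (N : nat) (G : sgraph 'I_N) (S : {set 'I_N}).
Local Notation A := (laplacian R (lift_graph G S)).
Local Notation T := (involution_mx N R).

Lemma heat_character_cvg (t : R) :
  series (fun k => k`!%:R^-1 * ((- t) ^+ k * \tr (A ^+ k *m T))) @ \oo -->
    heat_character G S t.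
Proof.
have := @trace_expmx_cvg _ _ (- t *: A) T.
rewrite -/(heat_character G S t); apply: cvg_trans; apply: near_eq_cvg.
apply: nearW => n; apply: eq_bigr => k _.
by rewrite scale_mx_exp -scalemxAl mxtraceZ.
Qed.

(** The constant 1 is expanded as the exponential of 0, whence the coefficient
    0^k, nonzero only for k = 0. *)
Lemma heat_spectrum_cvg (a t : R) :
  series (fun k => k`!%:R^-1 * ((- t) ^+ k * (0 ^+ k + a ^+ k - 1))) @ \oo -->
    1 + expR (- a * t) - expR (- t).
Proof.
pose e x := series (fun k => k`!%:R^-1 * x ^+ k : R).
rewrite (_ : series _ = e 0 + e (- a * t) - e (- t)); last first.
  apply/funext => n; rewrite /e /series /= !fctE -big_split -sumrB.
  apply: eq_bigr => k _ /=; rewrite -mulrDr -mulrBr; congr (_ * _).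
  by rewrite mulrBr mulrDr -!exprMn mulr0 mulr1 mulNr -mulrN mulrC.
rewrite -[in X in _ --> X]expR0.
by apply: cvgB; [apply: cvgD|]; exact: cvg_expR_series.
Qed.

Lemma heat_character_of_traces (a t : R) :
  (forall k, \tr (A ^+ k *m T) = 0 ^+ k + a ^+ k - 1) ->
  heat_character G S t = 1 + expR (- a * t) - expR (- t).
Proof.
move=> trA; apply: (@cvg_unique R _ _ _ _ _ (@heat_character_cvg t)) => //.
rewrite (_ : (fun k => _) =
  fun k => k`!%:R^-1 * ((- t) ^+ k * (0 ^+ k + a ^+ k - 1))).
  exact: heat_spectrum_cvg.
by apply/funext => k; rewrite trA.
Qed.

Lemma heat_character_unique (a : R) :
  (forall t : R, 0 < t ->
     heat_character G S t = 1 + expR (- a * t) - expR (- t)) ->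
  forall k, \tr (A ^+ k *m T) = 0 ^+ k + a ^+ k - 1.
Proof.
move=> chi k.
pose d k : R := \tr (A ^+ k *m T) - (0 ^+ k + a ^+ k - 1).
have /(_ k) : forall k, k`!%:R^-1 * (-1) ^+ k * d k = 0.
  apply: power_series_eq0 => t t0.
  pose h (u : R^nat) := series (fun k => k`!%:R^-1 * ((- t) ^+ k * u k)).
  rewrite (_ : series _ = h (fun k => \tr (A ^+ k *m T))
                        - h (fun k => 0 ^+ k + a ^+ k - 1)); last first.
    apply/funext => n; rewrite /h /series /= !fctE -sumrB.
    by apply: eq_bigr => l _; rewrite /d -[- t]mulN1r exprMn; ring.
  have chi0 : heat_character G S t - (1 + expR (- a * t) - expR (- t)) = 0.
    by rewrite chi// subrr.
  rewrite -[in X in _ --> X]chi0.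
  by apply: cvgB; [exact: heat_character_cvg|exact: heat_spectrum_cvg].
move/eqP; rewrite !mulf_eq0 invr_eq0 pnatr_eq0 eqn0Ngt fact_gt0.
by rewrite signr_eq0 subr_eq0 /= => /eqP.
Qed.

End Heat.

Theorem theorem5p13 (R : realType) (N : nat) (G : sgraph 'I_N) (S : {set 'I_N})
    (hS : (1 <= #|S|)%N) :
  [<-> exists P : {set {set 'I_N}}, P \subset components G /\ S = finset.cover P;
       loop_laplacian R G S *m loop_vec R S = loop_vec R S;
       forall p : R, 0 < p -> loop_resolvent G S p = #|S|%:R / (p + 1);
       forall t : R, 0 < t ->
         heat_character G S t
         = 1 + expR (- (2 * #|S|%:R + 1) * t) - expR (- t)].
Proof.
have S0 : S != finset.set0 by rewrite -card_gt0.
tfae.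
- by move/cover_components/loop_laplacian_eigen_closed.
- by move=> Ms p p0; apply: loop_resolvent_eigen.
- move/loop_resolvent_closed/loop_laplacian_eigen_closed => Ms t _.
  by apply: heat_character_of_traces => k; exact: trace_lift_pow_eigen.
- move/heat_character_unique/(_ 3%N); rewrite trace_lift_cube => q.
  apply/cover_components; apply: (closed_of_laplacian_form_le0 (R := R)).
  have -> : (loop_vec R S)^T *m (laplacian R G *m loop_vec R S)
      = (loop_vec R S)^T *m (loop_laplacian R G S *m loop_vec R S) - (#|S|%:R)%:M.
    by rewrite loop_laplacian_mul_loop_vec mulmxDr loop_vec_sqr addrK.
  rewrite mxE [X in _ + X]mxE [X in - X]mxE eqxx mulr1n.
  by move: q; rewrite expr0n /=; lra.
Qed.
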